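(* Let $S$ denote the long trap setting strategy (described in the context, with any rule for choosing among several eligible seats). For every strategy $K$ of the adaptive maître d' and every positive integer $n$, we have $c_K(n) \le c_S(n)$, where $c_K(n)$ denotes the expected number of diners who end up without a napkin when the maître d' follows $K$ at a circular table with $n$ seats.
   Context: Adaptive maître d' problem: $n$ diners are to be seated at a circular table with $n$ seats; between each pair of consecutive seats lies one napkin (so there are $n$ napkins). The maître d' seats the diners one at a time, each in an empty seat of his choice. When a diner sits down, they take a napkin adjacent to their seat that is still available (not yet taken): if both adjacent napkins are available they choose one uniformly at random, independently of everything else; if exactly one is available they take it; if none is available they get no napkin. The maître d' observes every napkin choice, and a strategy is any rule choosing the next empty seat as a function of everything observed so far. The maître d' wants to maximize the expected number of napkinless diners. An empty seat and an available napkin are called neighbors if the napkin is adjacent to the seat. The long trap setting strategy $S$ chooses each next seat as follows. (S1) If some available napkin neighbors exactly one empty seat, seat the next diner in that empty seat. (S2) Otherwise (every available napkin neighbors zero or two empty seats): if there is an empty seat $X$ which is three seats away from an occupied seat, with the two seats strictly between them both empty, seat the next diner in such a seat $X$; if there is no such seat, seat the next diner in any empty seat. *)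

(* Defs.v *)
From mathcomp Require Import all_boot all_order all_algebra.

Set Implicit Arguments.
Unset Strict Implicit.
Unset Printing Implicit Defensive.

Import GRing.Theory.

(* Seats and napkins are both indexed by 'I_n, cyclically via [ordS]: seat i  *)
(* has napkin i on one side and napkin [ordS i] on the other.  When n = 1 the *)
(* two coincide, and when n = 2 both seats are adjacent to both napkins.      *)
Definition adjacent n (j i : 'I_n) : bool := (j == i) || (j == ordS i).

(* One entry per seated diner, most recent first: the seat together with the *)
(* napkin taken there ([None] for a napkinless diner).                       *)
Definition history n := seq ('I_n * option 'I_n).

Definition is_empty n (h : history n) (i : 'I_n) : bool := i \notin unzip1 h.

Definition available n (h : history n) (j : 'I_n) : bool :=
  Some j \notin unzip2 h.

(* [b] is the diner's coin, relevant only if both napkins are available. *)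
Definition napkin_taken n (h : history n) (i : 'I_n) (b : bool) : option 'I_n :=
  match available h i, available h (ordS i) with
  | true, true => Some (if b then i else ordS i)
  | true, false => Some i
  | false, true => Some (ordS i)
  | false, false => None
  end.

Definition rule n := history n -> 'I_n.

Definition seat_next n (K : rule n) (h : history n) (b : bool) : history n :=
  (K h, napkin_taken h (K h) b) :: h.

(* The history produced by [K] when the successive coins are [w]. *)
Definition play n (K : rule n) (w : seq bool) : history n :=
  foldl (seat_next K) [::] w.

(* Only the histories that can actually arise under [K] are constrained. *)
Definition is_strategy n (K : rule n) : Prop :=
  forall w : seq bool, size w < n -> is_empty (play K w) (K (play K w)).

Definition napkinless n (h : history n) : nat := count_mem None (unzip2 h).

(* The n coins are independent and fair, i.e. uniform on n.-tuple bool. *)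
Definition expected_napkinless n (K : rule n) : rat :=
  ((\sum_(w : n.-tuple bool) (napkinless (play K w))%:R) / 2%:R ^+ n)%R.

Definition trap_napkin n (h : history n) (j : 'I_n) : bool :=
  available h j && (#|[set i | is_empty h i & adjacent j i]| == 1).

Definition S1_seat n (h : history n) (i : 'I_n) : bool :=
  is_empty h i && [exists j, trap_napkin h j && adjacent j i].

(* "Three seats away" is measured along either arc of the table. *)
Definition S2_seat n (h : history n) (i : 'I_n) : bool :=
  let three_away (step : 'I_n -> 'I_n) :=
    [&& is_empty h (step i), is_empty h (step (step i))
      & ~~ is_empty h (step (step (step i)))] in
  is_empty h i && (three_away (@ordS n) || three_away (@ord_pred n)).

Definition long_trap_seat n (h : history n) (i : 'I_n) : bool :=
  if [exists j, trap_napkin h j] then S1_seat h i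
  else if [exists k, S2_seat h k] then S2_seat h i
  else is_empty h i.

(* Ties among eligible seats may be broken in any history-dependent way. *)
Definition long_trap n (S : rule n) : Prop :=
  forall w : seq bool,
    size w < n -> long_trap_seat (play S w) (S (play S w)).

Lemma long_trap_is_strategy n (S : rule n) : long_trap S -> is_strategy S.
Proof.
move=> hS w /hS; rewrite /long_trap_seat /S1_seat /S2_seat.
by case: ifP => _; [case/andP | case: ifP => _ //; case/andP].
Qed.

(* Main.v *)
From HB Require Import structures.
Require Import Defs.
From mathcomp Require Import all_boot all_order all_algebra.
From mathcomp Require Import ring lra zify.

(** A taken napkin always lies next to an occupied seat, so once somebody is
    seated the table splits into independent runs of consecutive empty seats,
    and a run is described by its length k and by which of its two end napkins
    are available.  Let [value s k] be the expected number of napkinless diners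
    that the long trap setting strategy extracts from a run of k seats with s
    available end napkins.  The napkinless diners so far plus the values of the
    runs form a potential, whose expectation is preserved by the moves of the
    long trap setting strategy and is not increased by any other move.  The
    first diner leaves a run of n - 1 seats with one end napkin, whatever
    happens.

    Seating inside a run leaving p seats on one side and q on the other, with
    both napkins available, gives (by [valueS]) [value a.+1 p.+1 +
    value b.+1 q.+1].  So the supermartingale property amounts to some
    superadditivity of [value], which follows from bounds on the deviation of
    [value 1] and [value 2] from linear functions of slope 3/16. *)

Set Implicit Arguments.
Unset Strict Implicit.
Unset Printing Implicit Defensive.

Import Order.TTheory GRing.Theory Num.Theory.

(** * The value of a run *)

Local Open Scope ring_scope.

(** The last clause takes a seat next to an available end napkin. With [s = 0] and four or more
    seats the third seat is taken: its side of two seats contributes [value_rec 1 3 = 3/4], the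
    other side [value_rec 1 j]. *)
Fixpoint value_rec (s k : nat) : rat :=
  match k, s with
  | 0, _ => 0
  | 1, 0 => 1
  | j.+2, 0 => if (j < 2)%N then 1 else 3 / 4 + value_rec 1 j
  | k'.+1, s'.+1 => (value_rec s' k' + value_rec s k') / 2
  end.

(* Sealed because [lra] compares atoms up to conversion and would compute in *)
(* rat.                                                                      *)
HB.lock Definition value : nat -> nat -> rat := value_rec.

Lemma valueS s k : value s.+1 k.+1 = (value s k + value s.+1 k) / 2.
Proof. by rewrite value.unlock; case: k. Qed.

Lemma value0S k : value 0 k.+4 = 3 / 4 + value 1 k.+2.
Proof. by rewrite value.unlock. Qed.

Lemma value0n s : value s 0 = 0.
Proof. by rewrite value.unlock; case: s. Qed.

Lemma value0_small : [/\ value 0 1 = 1, value 0 2 = 1 & value 0 3 = 1].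
Proof. by rewrite value.unlock. Qed.

Lemma value1_small :
  [/\ value 1 1 = 0, value 1 2 = 1 / 2, value 1 3 = 3 / 4 & value 1 4 = 7 / 8].
Proof. by have [*] := value0_small; split; rewrite !valueS !value0n; lra. Qed.

(** * Deviations from linear growth *)

(** The slope 3/16 is forced by [value 1 (k+5) = (3/4 + value 1 (k+2) + value 1 (k+4)) / 2]. The
    offsets make both recurrences homogeneous and the linear parts cancel in the inequalities
    below. *)
HB.lock Definition dev1 (k : nat) : rat := value 1 k - 3 / 16 * (k%:R + 1).
HB.lock Definition dev2 (k : nat) : rat := value 2 k - 3 / 16 * (k%:R - 1).

Lemma dev1_rec k : dev1 k.+4.+1 = (dev1 k.+4 + dev1 k.+2) / 2.
Proof. by rewrite dev1.unlock (valueS 0 k.+4) value0S; lra. Qed.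

Lemma dev2_rec k : dev2 k.+1 = (dev1 k + dev2 k) / 2.
Proof. by rewrite ?dev1.unlock ?dev2.unlock valueS; lra. Qed.

Lemma dev1_small :
  [/\ dev1 1 = - (3 / 8), dev1 2 = - (1 / 16), dev1 3 = 0
    & dev1 4 = - (1 / 16)].
Proof.
by rewrite dev1.unlock; have [-> -> -> ->] := value1_small; split; lra.
Qed.

Lemma dev2_small : [/\ dev2 1 = 0, dev2 2 = - (3 / 16) & dev2 3 = - (1 / 8)].
Proof.
have [d1 d2 _ _] := dev1_small.
have d0 : dev2 1 = 0 by rewrite dev2.unlock valueS !value0n; lra.
have d3 : dev2 2 = - (3 / 16) by rewrite dev2_rec; lra.
by split; [exact: d0 | exact: d3 | rewrite dev2_rec; lra].
Qed.

(** Each term averages two of the three before it, so an interval containing three consecutive terms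
    contains all later ones. The upper end is half the lower one: two such deviations sum to at most
    [- (1 / 16)], which bounds a single one from below. *)
Lemma dev1_bounds k : - (1 / 16) <= dev1 k.+4 <= - (1 / 32).
Proof.
have [_ d2 d3 d4] := dev1_small.
suff: (- (1 / 16) <= dev1 k.+4 <= - (1 / 32)) &&
      (- (1 / 16) <= dev1 k.+4.+1 <= - (1 / 32)) &&
      (- (1 / 16) <= dev1 k.+4.+2 <= - (1 / 32)) by case/andP => /andP[].
elim: k => [|k IH]; first 
  by rewrite (dev1_rec 0) (dev1_rec 1) (dev1_rec 0); lra.
by rewrite (dev1_rec k.+2); lra.
Qed.

Lemma dev2_bounds k : - (1 / 16) <= dev2 k.+4 <= - (1 / 32).
Proof.
have [_ _ d3 _] := dev1_small; have [_ _ e3] := dev2_small.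
elim: k => [|k IH]; first by rewrite dev2_rec; lra.
by have := dev1_bounds k; rewrite (dev2_rec k.+4); lra.
Qed.

Lemma dev1_le0 k : dev1 k.+1 <= 0.
Proof.
have [d1 d2 d3 _] := dev1_small.
case: k => [|[|[|k]]]; [lra..|]; by have := dev1_bounds k; lra.
Qed.

Lemma dev1_ge k : - (1 / 16) <= dev1 k.+2.
Proof.
have [d1 d2 d3 _] := dev1_small.
case: k => [|[|k]]; [lra..|]; by have := dev1_bounds k; lra.
Qed.

Lemma dev2_le0 k : dev2 k.+1 <= 0.
Proof.
have [d1 d2 d3] := dev2_small.
case: k => [|[|[|k]]]; [lra..|]; by have := dev2_bounds k; lra.
Qed.

(** Settles [p = 2] in [value1_superadditive], where [dev1 3 = 0] leaves no slack. The two
    recurrences share a term, and induction compares the other ones. *)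
Lemma dev2_le_dev1 k : dev2 k.+1 <= dev1 k.+3.
Proof.
have [d1 d2 d3] := dev2_small; have [c1 c2 c3 c4] := dev1_small.
elim: k => [|[|[|k]] IH]; first lra.
- by have := dev1_ge 2; lra.
- by have := dev1_ge 3; lra.
by rewrite dev2_rec (dev1_rec k.+1); lra.
Qed.

(** * Superadditivity and monotonicity of the values *)

Lemma value1_superadditive p q :
  value 1 p.+1 + value 2 q.+1 <= value 1 (p + q).+1.
Proof.
have [d1 d2 d3] := dev2_small; have [c1 c2 c3 c4] := dev1_small.
suff: dev1 p.+1 + dev2 q.+1 <= dev1 (p + q).+1.
  by rewrite ?dev1.unlock ?dev2.unlock; lra.
case: q => [|q]; first by rewrite d1 addn0; lra.
have := dev1_ge (p + q); have := dev1_le0 p; have := dev2_le0 q.+1.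
rewrite -addnS.
case: p => [|[|[|p]]]; first by lra.
- case: q => [|[|q]]; [lra..|]; by have := dev2_bounds q; lra.
- by have := dev2_le_dev1 q.+1; rewrite c3 add0r !addSn add0n => *; lra.
case: q => [|[|q]]; [lra..|].
by have := dev2_bounds q; have := dev1_bounds p; lra.
Qed.

Lemma value2_superadditive p q :
  value 2 p.+1 + value 2 q.+1 <= value 2 (p + q).+1.
Proof.
have [d1 d2 d3] := dev2_small.
suff: dev2 p.+1 + dev2 q.+1 <= dev2 (p + q).+1.
  by rewrite dev2.unlock; lra.
case: p => [|p]; first by rewrite d1 add0n; lra.
case: q => [|q]; first by rewrite d1 addn0; lra.
have := dev2_le0 p.+1; have := dev2_le0 q.+1.
case: p => [|[|p]]; case: q => [|[|q]]; rewrite ?addSn ?addnS ?add0n ?addn0;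
  try by [lra | have := dev2_bounds q; have := dev2_bounds q.+1;
    have := dev2_bounds q.+2; lra | have := dev2_bounds p;
    have := dev2_bounds p.+1; have := dev2_bounds p.+2; lra
  | have := dev2_bounds 0; have := dev2_bounds 1; lra].
by have := dev2_bounds p; have := dev2_bounds q;
  have := dev2_bounds (p + q).+3; lra.
Qed.

(** This is an interior seat of a run without end napkins. As [dev1 3 = 0], equality holds for
    [p = 1] or [q = 1], that is, at the third seat from an end: hence rule (S2). *)
Lemma value1_split p q :
  value 1 p.+2 + value 1 q.+2 <= value 0 (p + q).+3.
Proof.
have [u1 u2 u3] := value0_small; have [v1 v2 v3 v4] := value1_small.
have [c1 c2 c3 c4] := dev1_small.
have [pq0|pq] := leqP (p + q) 0.
  have -> : p = 0%N by lia.
  have -> : q = 0%N by lia.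
  by rewrite add0n v2 u3; lra.
have -> : value 0 (p + q).+3 = 3 / 4 + value 1 (p + q).+1.
  by move: pq; case: (p + q)%N => [|k] pq; [lia | exact: value0S].
suff: dev1 p.+2 + dev1 q.+2 <= dev1 (p + q).+1.
  by rewrite dev1.unlock; lra.
case: p pq => [|[|p]] pq.
- case: q pq => [|q] pq; first by lia.
  rewrite add0n c2.
  have := dev1_ge q; case: q {pq} => [|q]; [lra|have := dev1_bounds q; lra].
- by rewrite c3 add1n; lra.
case: q pq => [|[|q]] pq.
- by rewrite addn0 c2; have := dev1_ge p.+1; have := dev1_bounds p; lra.
- by rewrite c3 addn1; lra.
have := dev1_bounds p; have := dev1_bounds q.
by have := dev1_ge (p.+1 + q.+2); rewrite addSn; lra.
Qed.

(** Serves for an end seat whose outer napkin is gone: the diner takes the inner one, and the run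
    just gets shorter. *)
Lemma value_leS s k : (s <= 2)%N -> value s k <= value s k.+1.
Proof.
have [u1 u2 u3] := value0_small; have [v1 v2 v3 v4] := value1_small.
have inc1 j : value 1 j <= value 1 j.+1.
  case: j => [|[|[|[|j]]]]; rewrite ?v1 ?v2 ?v3 ?v4 ?value0n; try lra.
  have := dev1_bounds j.+1; have := dev1_bounds j.
  by rewrite dev1.unlock; lra.
have inc2 : forall j, value 2 j <= value 2 j.+1.
  elim=> [|j IH]; first by rewrite valueS !value0n; lra.
  by have := valueS 1 j; have := valueS 1 j.+1; have := inc1 j; lra.
case: s => [|[|[|s]]] le2; [|exact: inc1|exact: inc2|by []].
case: k => [|[|[|[|k]]]]; rewrite ?value0n ?u1 ?u2 ?u3; try lra.
- by rewrite value0S v2; lra.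
- by rewrite !value0S; have := inc1 k.+2; lra.
Qed.

(** * Seating one diner inside a run *)

(* Availability of the napkin between the seat just taken and the p empty     *)
(* seats of the run on one side: for p = 0 it is the end napkin of the run.   *)
Definition end_napkin (a : bool) (p : nat) : bool := (p == 0%N) ==> a.

Lemma end_napkin0 a : end_napkin a 0 = a.
Proof. by []. Qed.

Lemma end_napkinS a p : end_napkin a p.+1.
Proof. by []. Qed.

(* Napkinless diner plus values of the two runs left when the seat between p  *)
(* and q empty ones is taken; coin c = true takes the napkin on the p side.   *)
Definition value_after (c a b : bool) (p q : nat) : rat :=
  let l := end_napkin a p in let r := end_napkin b q in
  (~~ l && ~~ r)%:R
    + (value (a + (l && r && ~~ c)) p + value ((l && r && c) + b) q).

(* The splits made by the long trap setting strategy, up to reflection: next  *)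
(* to an available end napkin, or, when there is none, at the third seat of   *)
(* the run, or anywhere in a run of at most two seats.                        *)
Definition trap_left (a b : bool) (p q : nat) : bool :=
  (if a then p == 0 else ~~ b && ((p == 2) || (p == 0) && (q <= 1)))%N.

Definition trap_split (a b : bool) (p q : nat) : bool :=
  trap_left a b p q || trap_left b a q p.

Lemma value_afterC c a b p q :
  value_after c a b p q = value_after (~~ c) b a q p.
Proof.
by rewrite /value_after negbK [_ && ~~ end_napkin a p]andbC
  [end_napkin b q && _]andbC [(_ + a)%N]addnC [(b + _)%N]addnC
  [value _ q + _]addrC.
Qed.

(** If both napkins are available, each side keeps its napkin under one coin and loses it under the
    other, so [valueS] recombines the two coins side by side. *)
Lemma value_after_sum a b p q :
  value_after true a b p q + value_after false a b p q =
  if end_napkin a p && end_napkin b q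
  then 2 * (value a.+1 p.+1 + value b.+1 q.+1)
  else 2 * ((~~ end_napkin a p && ~~ end_napkin b q)%:R
            + value a p + value b q).
Proof.
rewrite /value_after; case: end_napkin; case: end_napkin => /=;
  rewrite ?addn0 ?add0n ?addn1 ?add1n ?valueS; lra.
Qed.

Lemma value_after_le a b p q :
  value_after true a b p q + value_after false a b p q
    <= 2 * value (a + b) (p + q).+1.
Proof.
have [u1 u2 u3] := value0_small.
rewrite value_after_sum; have [/andP[]|] := boolP (_ && _).
  have := value1_superadditive p q; have := value1_superadditive q p.
  have := value2_superadditive p q; rewrite [(q + p)%N]addnC.
  case: a; case: b; rewrite ?addn0 ?add0n ?addn1 => V2 V1 V1'; [lra..|].
  (* Without end napkins, both napkins are available only at an interior seat. *)
  case: p q V2 V1 V1' => [|p] [|q] _ _ _; rewrite ?end_napkin0 => l r;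
    [by []..|].
  by have := value1_split p q; rewrite addSn addnS; lra.
have le0 k := @value_leS 0 k isT; have le1 k := @value_leS 1 k isT.
have v11 : value 1 1 = 0 by rewrite valueS !value0n; lra.
(* A missing napkin is an end napkin, so the seat is at an end of the run. *)
case: p => [|p]; case: q => [|q];
  rewrite ?end_napkin0 ?end_napkinS ?add0n ?addn0 ?value0n.
- by case: a; case: b => h; rewrite ?u1 ?v11; move: h; rewrite /=; lra.
- case: a => h; first by [].
  by case: b {h}; rewrite /= ?add0n; have := le0 q.+1; have := le1 q.+1; lra.
- case: b => h; first by rewrite andbT in h.
  by case: a {h}; rewrite /= ?addn0; have := le0 p.+1; have := le1 p.+1; lra.
- by [].
Qed.

Lemma value_after_eq a b p q : trap_split a b p q ->
  value_after true a b p q + value_after false a b p q =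
    2 * value (a + b) (p + q).+1.
Proof.
wlog: a b p q / trap_left a b p q => [hwlog /orP[h|h]|].
- by apply: hwlog; rewrite /trap_split ?h.
- rewrite (value_afterC true) (value_afterC false) [(p + q)%N]addnC.
  by rewrite [(a + b)%N]addnC addrC; apply: hwlog; rewrite /trap_split ?h.
move=> h _; have [u1 u2 u3] := value0_small.
have [v11 v2 v3 v4] := value1_small.
have v21 : value 2 1 = 0 by rewrite valueS !value0n; lra.
rewrite value_after_sum; case: a h => [/eqP->|].
  rewrite !end_napkin0 add0n; case: q => [|q];
    rewrite ?end_napkinS ?end_napkin0; case: b;
    by rewrite ?value0n ?v11 ?v21 ?u1 /=; lra.
case/andP => /negPf-> /orP[/eqP->|/andP[/eqP->]].
  rewrite end_napkinS add0n; case: q => [|q]; rewrite ?end_napkinS ?end_napkin0.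
    by rewrite /= ?addn0 u2 u3 value0n; lra.
  by rewrite add2n value0S v3 /=; lra.
case: q => [|[|q]] //; rewrite ?end_napkinS ?end_napkin0 /= => _;
  by rewrite ?value0n ?add0n ?u1 ?u2; lra.
Qed.

(* Decomposition of the table into runs *)
Local Close Scope ring_scope.

(* [(i, k, a, b)] stands for the k consecutive empty seats from seat i on; a  *)
(* and b tell whether the napkins at its two ends are available.              *)
Definition run n := ('I_n * nat * bool * bool)%type.

Definition run_seats n (r : run n) : seq 'I_n :=
  let: (i, k, _, _) := r in traject (@ordS n) i k.

Definition run_length n (r : run n) : nat := let: (_, k, _, _) := r in k.

Definition value_of_run n (r : run n) : rat :=
  let: (_, k, a, b) := r in value (a + b) k.

(** Vacuous for [k = 0]: a split at an end leaves an empty run whose flags need not match the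
    napkins. The two bounding occupied seats may coincide, as after the first diner. *)
Definition run_ok n (h : history n) (r : run n) : Prop :=
  let: (i, k, a, b) := r in 0 < k ->
  [/\ ~~ is_empty h (ord_pred i), ~~ is_empty h (iter k (@ordS n) i)
    & forall p, p <= k -> available h (iter p (@ordS n) i) =
        if p == 0 then a else if p == k then b else true].

Definition covers n (h : history n) (L : seq (run n)) : Prop :=
  [/\ uniq (flatten (map (@run_seats n) L)),
      forall y, is_empty h y = (y \in flatten (map (@run_seats n) L))
    & {in L, forall r, run_ok h r}].

Lemma covers_perm n (h : history n) L L' :
  perm_eq L L' -> covers h L -> covers h L'.
Proof.
move=> LL' [Lu Le Lok].
have fLL' := perm_flatten (perm_map (@run_seats n) LL').
split=> [|y|r]; first by rewrite -(perm_uniq fLL').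
- by rewrite Le (perm_mem fLL').
- by rewrite -(perm_mem LL'); apply: Lok.
Qed.

Lemma covers_locate n (h : history n) L x : covers h L -> is_empty h x ->
  exists i k a b L' p,
    [/\ perm_eq L ((i, k, a, b) :: L'), p < k & x = iter p (@ordS n) i].
Proof.
case=> _ -> _ /flatten_mapP[[[[i k] a] b] rL /= /trajectP[p pk ->]].
by exists i, k, a, b, (rem (i, k, a, b) L), p; split=> //; apply: perm_to_rem.
Qed.

Lemma is_empty_cons n (h : history n) x t y :
  is_empty ((x, t) :: h) y = (y != x) && is_empty h y.
Proof. by rewrite /is_empty inE negb_or. Qed.

Lemma available_cons n (h : history n) x t y :
  available ((x, t) :: h) y = (Some y != t) && available h y.
Proof. by rewrite /available inE negb_or. Qed.

Lemma napkin_takenP n (h : history n) x c y :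
  y != x -> y != ordS x -> Some y != napkin_taken h x c.
Proof.
rewrite /napkin_taken => yx yx'.
by case: available; case: available; case: c => //;
  apply: contraNneq yx => [[->]] //; rewrite eqxx in yx'.
Qed.

(** * Splitting the first run of a cover *)

Section RunSplit.

Variables (n : nat) (h : history n) (i : 'I_n) (k : nat) (a b : bool).
Variables (L : seq (run n)) (p : nat).
Hypothesis cov : covers h ((i, k, a, b) :: L).
Hypothesis pk : p < k.

Let k_gt0 : 0 < k. Proof. by case: k pk. Qed.

Lemma head_ok :
  [/\ ~~ is_empty h (ord_pred i), ~~ is_empty h (iter k (@ordS n) i)
    & forall p, p <= k -> available h (iter p (@ordS n) i) =
        if p == 0 then a else if p == k then b else true].
Proof. by case: cov => _ _ /(_ (i, k, a, b)); rewrite inE eqxx; apply. Qed.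

Lemma head_empty j : j < k -> is_empty h (iter j (@ordS n) i).
Proof.
case: cov => _ -> _ jk; rewrite /= mem_cat; apply/orP; left.
by apply/trajectP; exists j.
Qed.

(** The last entry is the occupied seat closing the run, which lies in no run. Hence the [k + 1]
    napkins along the run are distinct although the table is circular. *)
Lemma head_uniq : uniq (traject (@ordS n) i k.+1).
Proof.
rewrite trajectSr rcons_uniq; case: cov => /= + le _.
rewrite cat_uniq => /andP[-> _]; rewrite andbT.
by have [_ + _] := head_ok; rewrite le /= mem_cat negb_or => /andP[].
Qed.

Lemma iter_eq j1 j2 : j1 <= k -> j2 <= k ->
  (iter j1 (@ordS n) i == iter j2 (@ordS n) i) = (j1 == j2).
Proof.
move=> j1k j2k.
rewrite -(@nth_traject _ _ j1 k.+1) // -(@nth_traject _ _ j2 k.+1) //.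
by rewrite nth_uniq ?size_traject ?head_uniq.
Qed.

Let x := iter p (@ordS n) i.
Let q := (k - p.+1)%N.
Let l := end_napkin a p.
Let r := end_napkin b q.

Lemma napkin_left : available h x = l.
Proof.
have [_ _ -> /=] := head_ok; last exact: ltnW.
by rewrite /l /end_napkin; case: eqP => // _; rewrite (ltn_eqF pk).
Qed.

Lemma napkin_right : available h (ordS x) = r.
Proof.
have [_ _ h3] := head_ok; rewrite -iterS h3 //=.
rewrite /r /end_napkin subn_eq0 eqn_leq pk /=.
by case: leqP.
Qed.

Variable c : bool.
Let h' : history n := (x, napkin_taken h x c) :: h.

Lemma x_neq : (x == ordS x) = false.
Proof. by rewrite -iterS iter_eq ?(ltnW pk) // ltn_eqF. Qed.

Lemma napkin_left_after : available h' x = l && r && ~~ c.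
Proof.
rewrite available_cons /napkin_taken napkin_left napkin_right.
have := x_neq.
have someE u v : (Some u == Some v) = (u == v :> 'I_n) by [].
by case: l; case: r; case: c => //= xn; rewrite someE ?xn ?eqxx.
Qed.

Lemma napkin_right_after : available h' (ordS x) = l && r && c.
Proof.
rewrite available_cons /napkin_taken napkin_left napkin_right.
have := x_neq; rewrite eq_sym.
have someE u v : (Some u == Some v) = (u == v :> 'I_n) by [].
by case: l; case: r; case: c => //= xn; rewrite someE ?xn ?eqxx.
Qed.

Lemma napkinless_after : napkinless h' = ((~~ l && ~~ r) + napkinless h)%N.
Proof.
rewrite /napkinless /= /napkin_taken napkin_left napkin_right.
by case: l; case: r; case: c.
Qed.

Lemma other_available y : y != x -> y != ordS x ->
  available h' y = available h y.
Proof. by move=> yx yx'; rewrite available_cons napkin_takenP. Qed.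

Lemma covers_split :
  covers h' [:: (i, p, a, l && r && ~~ c), (ordS x, q, l && r && c, b) & L].
Proof.
have [pred_occ end_occ av] := head_ok.
have Ek : k = (p + q.+1)%N by rewrite /q addnS -addSn subnKC.
have segE : traject (@ordS n) i k =
    traject (@ordS n) i p ++ x :: traject (@ordS n) (ordS x) q.
  by rewrite Ek trajectD trajectS.
have [Lu Le Lok] := cov.
move: Lu; rewrite /= segE -!catA cat_cons => Lu.
have perm_x : perm_eq
  (traject (@ordS n) i p ++ x :: traject (@ordS n) (ordS x) q ++
    flatten (map (@run_seats n) L))
  (x :: traject (@ordS n) i p ++ traject (@ordS n) (ordS x) q ++
    flatten (map (@run_seats n) L)).
  by rewrite -cat1s perm_catCA.
move: (Lu); rewrite (perm_uniq perm_x) cons_uniq => /andP[xn Lu'].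
have occ y : ~~ is_empty h y -> ~~ is_empty h' y.
  by rewrite is_empty_cons => /negPf->; rewrite andbF.
split=> [//|y|].
  rewrite is_empty_cons Le /= segE -!catA cat_cons (perm_mem perm_x) inE.
  by case: eqP => [->|] //=; rewrite (negPf xn).
move=> s; rewrite !inE => /or3P[/eqP->|/eqP->|sL].
- move=> p_gt0; split; first exact: occ.
    by rewrite is_empty_cons eqxx.
  move=> j; rewrite leq_eqVlt => /orP[/eqP->|jp].
    by rewrite napkin_left_after eqxx; case: p p_gt0.
  rewrite other_available ?av ?(ltn_eqF jp) ?(ltn_eqF (ltn_trans jp pk)) //;
    try lia.
  + by rewrite iter_eq; lia.
  + by rewrite -iterS iter_eq; lia.
- move=> q_gt0; split.
  + by rewrite ordSK is_empty_cons eqxx.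
  + by rewrite -iterSr -iterD addnC -Ek occ.
  case=> [_|j jq]; first by rewrite napkin_right_after.
  rewrite -iterSr -iterD other_available ?av.
  + by rewrite Ek; congr (if _ then _ else _); lia.
  + by lia.
  + by rewrite iter_eq; lia.
  + by rewrite -iterS iter_eq; lia.
case: s sL => [[[i2 k2] a2] b2] sL k2_gt0.
have [||pred2 end2 av2] := Lok (i2, k2, a2, b2); rewrite ?inE ?sL ?orbT //.
split; [exact: occ|exact: occ|move=> j jk].
have x_empty : is_empty h x by apply: head_empty.
(* A napkin of another run adjacent to [x] would make [x] a seat of that run or one of the occupied
   seats bounding it. *)
have x_notin m : m < k2 -> iter m (@ordS n) i2 != x.
  move=> mk; apply: contraNneq xn => <-; rewrite !mem_cat.
  apply/orP; right; apply/orP; right; apply/flatten_mapP.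
  by exists (i2, k2, a2, b2) => //; apply/trajectP; exists m.
rewrite other_available ?av2 //.
- move: jk; rewrite leq_eqVlt => /orP[/eqP->|/x_notin//].
  by apply: contraNneq end2 => ->.
- case: j jk => [|j] jk.
    by apply: contraNneq pred2 => /= ->; rewrite ordSK.
  by rewrite iterS (inj_eq (@ordS_inj n)) x_notin.
Qed.

Lemma head_is_empty j : j <= k -> is_empty h (iter j (@ordS n) i) = (j < k).
Proof.
rewrite leq_eqVlt => /orP[/eqP->|jk]; last by rewrite jk head_empty.
by have [_ /negPf-> _] := head_ok; rewrite ltnn.
Qed.

Lemma trap_left_end : a -> trap_napkin h i.
Proof.
have [pred_occ _ av] := head_ok => ha.
rewrite /trap_napkin (av 0) //= ha /=; apply/cards1P; exists i.
apply/setP => y; rewrite !inE /adjacent eq_sym; case: eqP => [->|_] /=.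
  by rewrite andbT (head_empty k_gt0).
by apply/negP => /andP[ye /eqP iy]; move: pred_occ; rewrite iy ordSK ye.
Qed.

Lemma trap_right_end : b -> trap_napkin h (iter k (@ordS n) i).
Proof.
have [_ end_occ av] := head_ok => hb.
rewrite /trap_napkin av // eqxx hb eqn0Ngt k_gt0 /=; apply/cards1P.
exists (iter k.-1 (@ordS n) i); apply/setP => y; rewrite !inE /adjacent.
have -> : (iter k (@ordS n) i == ordS y) = (y == iter k.-1 (@ordS n) i).
  by rewrite -{1}(prednK k_gt0) iterS (inj_eq (@ordS_inj n)) eq_sym.
rewrite [_ == y]eq_sym.
case: (eqVneq y (iter k.-1 _ _)) => [->|_].
  by rewrite orbT head_is_empty ?leq_pred // prednK ?leqnn.
by rewrite orbF; apply/negP => /andP[ye /eqP yk]; rewrite -yk ye in end_occ.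
Qed.

(** A napkin strictly inside the run has two empty neighbors, so a trap must be an end napkin. *)
Lemma trap_adjacent j : trap_napkin h j -> adjacent j x ->
  a && (p == 0) || b && (q == 0).
Proof.
case/andP=> j_av /cards1P[z jz] /orP[/eqP jx|/eqP jx]; subst j.
  have p0 : p = 0.
    case Ep: p => [//|p'].
    have xE : x = ordS (iter p' (@ordS n) i) by rewrite -iterS -Ep.
    have : iter p' (@ordS n) i \in [set z].
      by rewrite -jz inE /adjacent -xE eqxx orbT head_empty //; lia.
    have : x \in [set z].
      by rewrite -jz inE /adjacent eqxx head_empty.
    rewrite !inE => /eqP<- /eqP/esym/eqP; rewrite iter_eq; lia.
  by move: j_av; rewrite napkin_left /l p0 end_napkin0 => ->.
have q0 : q = 0.
  case: (posnP q) => // q_gt0.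
  have : ordS x \in [set z].
    by rewrite -jz inE /adjacent eqxx -iterS head_empty //; lia.
  have : x \in [set z].
    by rewrite -jz inE /adjacent eqxx orbT head_empty.
  by rewrite !inE => /eqP<-; rewrite eq_sym x_neq.
by move: j_av; rewrite napkin_right /r q0 end_napkin0 => ->; rewrite orbT.
Qed.

Lemma long_trap_split : long_trap_seat h x -> trap_split a b p q.
Proof.
have [pred_occ end_occ _] := head_ok.
rewrite /long_trap_seat; case: ifP => [_|/existsP no_trap].
  case/andP => _ /existsP[j /andP[/trap_adjacent jx /jx]].
  by rewrite /trap_split /trap_left; case/orP => /andP[-> ->]; rewrite ?orbT.
have /negPf-> : ~~ a.
  by apply/negP => /trap_left_end ?; apply: no_trap; exists i.
have /negPf-> : ~~ b.
  apply/negP => /trap_right_end ?; apply: no_trap.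
  by exists (iter k (@ordS n) i).
rewrite /trap_split /trap_left /=; case: ifP => [_|/existsP no_S2 _].
  case/andP => _ /orP[] /and3P[].
    rewrite -!iterS => e1 e2 e3; rewrite head_is_empty in e1; last exact: pk.
    rewrite head_is_empty in e2; last exact: e1.
    rewrite head_is_empty in e3; last exact: e2.
    lia.
  (* Going backwards, [p <= 1] meets the occupied seat before [i] too early, and [p >= 3] still
     finds an empty seat after three steps. *)
  rewrite /x /q; case Ep: p => [|[|[|p']]] /=.
  - by rewrite (negPf pred_occ).
  - by rewrite ordSK (negPf pred_occ).
  - by [].
  by rewrite !ordSK head_empty; lia.
(* A run of three or more seats would offer (S2) its third seat from the end. *)
have [k3|] := leqP 3 k; last by rewrite /q; lia.
case: no_S2; exists (iter (k - 3) (@ordS n) i).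
rewrite /S2_seat -!iterS !head_is_empty; lia.
Qed.

Local Open Scope ring_scope.

Lemma napkin_value_after :
  (napkinless h')%:R + \sum_(s <- [:: (i, p, a, l && r && ~~ c),
      (ordS x, q, l && r && c, b) & L]) value_of_run s =
  value_after c a b p q
    + ((napkinless h)%:R + \sum_(s <- L) value_of_run s) :> rat.
Proof.
rewrite !big_cons napkinless_after natrD /value_after -/l -/r /value_of_run.
by rewrite [(_ + b)%N]addnC; lra.
Qed.

End RunSplit.

(** * The potential and its change in one move *)

Local Open Scope ring_scope.

Definition potential n (h : history n) (L : seq (run n)) : rat :=
  (napkinless h)%:R + \sum_(s <- L) value_of_run s.

(** The total length is tracked so that after the last diner only empty runs remain and the
    potential is the number of napkinless diners. *)
Lemma covers_step n (h : history n) L x : covers h L -> is_empty h x ->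
  exists L' : bool -> seq (run n),
  let h' c := (x, napkin_taken h x c) :: h in
  [/\ forall c, covers (h' c) (L' c),
      forall c, (\sum_(s <- L) run_length s)%N
        = (\sum_(s <- L' c) run_length s).+1,
      potential (h' true) (L' true) + potential (h' false) (L' false)
        <= 2 * potential h L
    & long_trap_seat h x ->
      potential (h' true) (L' true) + potential (h' false) (L' false)
        = 2 * potential h L].
Proof.
move=> covL xe.
have [i [k [a [b [L0 [p [LL0 pk xE]]]]]]] := covers_locate covL xe.
have cov := covers_perm LL0 covL.
rewrite xE.
have kE : (p + (k - p.+1)).+1 = k by lia.
have valE : potential h L =
    value (a + b) k + ((napkinless h)%:R + \sum_(s <- L0) value_of_run s).
  by rewrite /potential (perm_big _ LL0) big_cons /=; lra.
pose r := end_napkin a p && end_napkin b (k - p.+1).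
exists (fun c => [:: (i, p, a, r && ~~ c),
  (ordS (iter p (@ordS n) i), (k - p.+1)%N, r && c, b) & L0]) => /=; split.
- by move=> c; apply: covers_split cov pk c.
- by move=> c; rewrite (perm_big _ LL0) !big_cons /= -{1}kE addSn addnA.
- rewrite valE /potential !(napkin_value_after cov pk).
  by have := value_after_le a b p (k - p.+1); rewrite kE; lra.
move=> /(long_trap_split cov pk) /value_after_eq; rewrite kE => vE.
by rewrite valE /potential !(napkin_value_after cov pk); lra.
Qed.

(** * The table after the first diner *)

Lemma iter_ordS_val n (x : 'I_n) j :
  iter j (@ordS n) x = ((x + j) %% n)%N :> nat.
Proof.
elim: j => [|j IH] /=; first by rewrite addn0 modn_small.
by rewrite IH -addn1 modnDml addn1 addnS.
Qed.

Lemma iter_ordS_eq n (x : 'I_n) j1 j2 :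
  (iter j1 (@ordS n) x == iter j2 (@ordS n) x) = (j1 == j2 %[mod n])%N.
Proof. by rewrite -val_eqE /= !iter_ordS_val eqn_modDl. Qed.

Lemma traject_ordS_uniq n (x : 'I_n) : uniq (traject (@ordS n) x n).
Proof.
apply/(uniqP x) => j1 j2; rewrite !inE size_traject => j1n j2n.
rewrite !nth_traject // => /eqP; rewrite iter_ordS_eq.
by rewrite !modn_small // => /eqP.
Qed.

Lemma mem_traject_ordS n (x y : 'I_n) : y \in traject (@ordS n) x n.
Proof.
have n_gt0 : (0 < n)%N by case: n x {y} => [[]|].
apply/trajectP; exists ((y + (n - x)) %% n)%N; first by rewrite ltn_mod.
apply/val_inj; rewrite /= iter_ordS_val modnDmr.
have -> : (x + (y + (n - x)) = y + n)%N by have := ltn_ord x; lia.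
by rewrite modnDr modn_small.
Qed.

(** The seat [x] bounds the run on both sides. For [n >= 2] exactly one of its napkins is left, at
    the end given by the coin; for [n = 1] the run is empty. *)
Lemma covers_first n (x : 'I_n) c :
  covers [:: (x, napkin_taken [::] x c)] [:: (ordS x, n.-1, c, ~~ c)].
Proof.
have n_gt0 : (0 < n)%N by case: n x => [[]|].
have taken : napkin_taken [::] x c = Some (if c then x else ordS x) by [].
have := traject_ordS_uniq x; have := mem_traject_ordS x.
have -> : traject (@ordS n) x n = x :: traject (@ordS n) (ordS x) n.-1.
  by rewrite -trajectS prednK.
move=> memx /andP[xn un].
split=> [|y|s]; first by rewrite /= cats0.
  rewrite is_empty_cons andbT /= cats0.
  by have := memx y; rewrite inE; case: eqP => //= ->; rewrite (negPf xn).
rewrite inE => /eqP-> n1_gt0; rewrite ordSK -iterSr prednK //.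
split.
- by rewrite is_empty_cons eqxx.
- by rewrite is_empty_cons -[x in _ != x]/(iter 0 (@ordS n) x) iter_ordS_eq
    modnn mod0n eqxx.
move=> p pn; rewrite available_cons andbT -iterSr taken.
have -> y z : (Some y == Some z) = (y == z :> 'I_n) by [].
(* With both napkins of [x] written as iterates from [x], comparing napkins becomes a congruence
   modulo [n]. *)
rewrite -[x in if _ then x else _]/(iter 0 (@ordS n) x).
rewrite -[ordS x]/(iter 1 (@ordS n) x) -(fun_if (fun j => iter j (@ordS n) x)).
rewrite iter_ordS_eq; case: c {taken}.
  rewrite mod0n; case: (ltngtP p n.-1) pn => // [pn _|-> _].
    rewrite modn_small; last by lia.
    by rewrite if_same.
  by rewrite prednK // modnn (gtn_eqF n1_gt0) ?eqxx.
rewrite [X in _ != X]modn_small; last by lia.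
case: (ltngtP p n.-1) pn => // [pn _|-> _].
  by rewrite modn_small ?if_same; [case: p {pn}|lia].
by rewrite prednK // modnn (gtn_eqF n1_gt0) ?eqxx.
Qed.

(** * Summation over the coins *)

Lemma big_tuple_cons m (F : seq bool -> rat) :
  \sum_(w : m.+1.-tuple bool) F w =
  \sum_(w : m.-tuple bool) F (true :: w)
  + \sum_(w : m.-tuple bool) F (false :: w).
Proof.
rewrite (reindex (fun bw : bool * m.-tuple bool => cons_tuple bw.1 bw.2)) /=.
  by rewrite -(pair_bigA_idem _ (fun b (w : m.-tuple bool) => F (b :: w)))
    ?big_bool.
exists (fun w => (thead w, [tuple of behead w])) => [[b w]|w] _ /=.
  by congr (_, _); apply/val_inj.
by rewrite [RHS]tuple_eta.
Qed.

Lemma play_rcons n (K : rule n) w c :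
  play K (rcons w c) = seat_next K (play K w) c.
Proof. exact: foldl_rcons. Qed.

(** The factor [2 ^+ m] turns the expectation over the remaining coins into a sum. Induction splits
    off the next coin, whose two outcomes [covers_step] compares. *)
Lemma sum_napkinless_from n (K : rule n) m w L :
  is_strategy K -> (size w + m = n)%N -> covers (play K w) L ->
  (\sum_(s <- L) run_length s = m)%N ->
  let total := \sum_(v : m.-tuple bool) (napkinless (play K (w ++ v)))%:R in
  let bound := 2 ^+ m * potential (play K w) L in
  total <= bound /\ (long_trap K -> total = bound).
Proof.
move=> strat; elim: m w L => [|m IH] w L size_w cov len.
  suff -> : \sum_(v : 0.-tuple bool) (napkinless (play K (w ++ v)))%:R =
      2 ^+ 0 * potential (play K w) L by [].
  rewrite (big_pred1 [tuple]) => [|v]; last by apply/esym/eqP; exact: tuple0.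
  rewrite cats0 expr0 mul1r /potential big1_seq ?addr0 // => s /andP[_ sL].
  move/eqP: len; rewrite sum_nat_seq_eq0 => /allP/(_ s sL) /=.
  by case: s {sL} => [[[i k] a] b] /= /eqP->; rewrite value0n.
have w_lt : (size w < n)%N by lia.
have [L' [cov' len' le_pot eq_pot]] := covers_step cov (strat w w_lt).
have sizes c : (size (rcons w c) + m = n)%N by rewrite size_rcons; lia.
have covc c : covers (play K (rcons w c)) (L' c).
  by rewrite play_rcons; apply: cov'.
have lenc c : (\sum_(s <- L' c) run_length s = m)%N.
  by have := len' c; rewrite len => -[].
have [le1 eq1] := IH _ _ (sizes true) (covc true) (lenc true).
have [le0 eq0] := IH _ _ (sizes false) (covc false) (lenc false).
move=> total bound.
have -> : total =
    \sum_(v : m.-tuple bool) (napkinless (play K (rcons w true ++ v)))%:R +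
    \sum_(v : m.-tuple bool) (napkinless (play K (rcons w false ++ v)))%:R.
  pose F v : rat := (napkinless (play K (w ++ v)))%:R.
  rewrite /total (big_tuple_cons _ F).
  by congr (_ + _); apply: eq_bigr => v _; rewrite cat_rcons.
rewrite {}/bound {total}.
have pow_gt0 : 0 < 2 ^+ m :> rat by rewrite exprn_gt0.
rewrite !play_rcons in le1 le0 eq1 eq0.
split=> [|trapK].
  apply: le_trans (lerD le1 le0) _.
  by rewrite -mulrDr exprSr -mulrA ler_pM2l.
by rewrite eq1 // eq0 // -mulrDr eq_pot ?exprSr ?mulrA //; apply: trapK.
Qed.

(** The first coin is treated apart, since a run needs an occupied seat to bound it. *)
Lemma expected_napkinless_value n (K : rule n) : (0 < n)%N -> is_strategy K ->
  expected_napkinless K <= value 1 n.-1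
  /\ (long_trap K -> expected_napkinless K = value 1 n.-1).
Proof.
case: n K => // m K _ strat; rewrite /expected_napkinless.
have covc c : covers (play K [:: c]) [:: (ordS (K [::]), m, c, ~~ c)].
  exact: covers_first.
have lenc c : (\sum_(s <- [:: (ordS (K [::]), m, c, ~~ c)]) run_length s = m)%N.
  by rewrite big_cons big_nil addn0.
have potc c :
    potential (play K [:: c]) [:: (ordS (K [::]), m, c, ~~ c)] = value 1 m.
  rewrite /potential big_cons big_nil addr0.
  by rewrite [napkinless _](_ : _ = 0%N) ?add0r //=; case: c.
have [le1 eq1] :=
  sum_napkinless_from (w := [:: true]) strat (add1n m)
    (covc true) (lenc true).
have [le0 eq0] :=
  sum_napkinless_from (w := [:: false]) strat (add1n m)
    (covc false) (lenc false).
rewrite !potc in le1 le0 eq1 eq0.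
rewrite (big_tuple_cons _ (fun v => (napkinless (play K v))%:R)).
have pow_gt0 : 0 < 2 ^+ m :> rat by rewrite exprn_gt0.
have boundE : 2 ^+ m * value 1 m + 2 ^+ m * value 1 m = value 1 m * 2 ^+ m.+1.
  by rewrite exprS; ring.
split=> [|trapK].
  by rewrite ler_pdivrMr ?exprn_gt0 // -boundE lerD.
by rewrite eq1 // eq0 // boundE mulfK // expf_neq0.
Qed.

Local Close Scope ring_scope.

Theorem theorem1p1 (n : nat) (n_gt0 : 0 < n)
    (S : rule n) (hS : long_trap S) (K : rule n) (hK : is_strategy K) :
  (expected_napkinless K <= expected_napkinless S)%R.
Proof.
have [leK _] := expected_napkinless_value n_gt0 hK.
have [_ eqS] := expected_napkinless_value n_gt0 (long_trap_is_strategy hS).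
by rewrite eqS.
Qed.
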